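(* (Strong Parity Theorem.) Let $\mathcal U\in\mathcal L(\mathcal A_{\mathsf P})$ be a subspace whose defining move equations involve $\kappa$ pieces, and suppose the quasipolynomial $\alpha(\mathcal U;n)$ has period $p$. Then the number of values of $\alpha(\mathcal U;n)$ that are sufficient to determine all the coefficients in all constituents of $\alpha(\mathcal U;n)$ is $\lceil p(\kappa-\tfrac12\operatorname{codim}\mathcal U)\rceil+\epsilon$, where $\epsilon=1$ if $\operatorname{codim}\mathcal U$ is even and $\epsilon=0$ if it is odd.
   Context: A rider piece $\mathsf P$ has a finite set $\mathcal M$ of basic moves: nonzero integer vectors $m=(c,d)$ with $\gcd(c,d)=1$, no two parallel. For $q$ pieces, configurations are points $(z_1,\dots,z_q)\in\mathbb R^{2q}$, $z_i=(x_i,y_i)$. The move arrangement $\mathcal A_{\mathsf P}$ consists of the hyperplanes $\mathcal H^{d/c}_{ij}=\{(z_1,\dots,z_q):(z_j-z_i)\cdot(d,-c)=0\}$ for $i<j$ and $(c,d)\in\mathcal M$; $\mathcal L(\mathcal A_{\mathsf P})$ is the set of intersections of subsets of these hyperplanes. For $\mathcal U\in\mathcal L(\mathcal A_{\mathsf P})$ involving a set of $\kappa$ pieces, its essential part $\tilde{\mathcal U}\subseteq\mathbb R^{2\kappa}$ is the subspace defined by the same move equations in the coordinates of those $\kappa$ pieces, and $\alpha(\mathcal U;n)$ is the number of integral points in $(n+1)\cdot\big((0,1)^{2\kappa}\cap\tilde{\mathcal U}\big)$. It is known (Ehrhart theory) that $\alpha(\mathcal U;n)$ is a quasipolynomial in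 $n$ of degree $d=2\kappa-\operatorname{codim}\mathcal U$ whose leading coefficient is the same known constant for all constituents, and (parity/reciprocity) that its constituents $\alpha_0,\dots,\alpha_{p-1}$ (with $\alpha(n)=\alpha_{n\bmod p}(n)$, indices mod $p$) satisfy $\alpha_{-i}(-n)=(-1)^d\alpha_i(n)$. *)

(* Defs.v *)
From HB Require Import structures.
From mathcomp Require Import all_boot all_order all_algebra.
Unset Printing Implicit Defensive.
Import Order.TTheory GRing.Theory Num.Theory.
Local Open Scope ring_scope.

(* A rider piece is given by its list of basic moves (c,d). *)
Definition move_of (M : seq (int * int)) (k : 'I_(size M)) : int * int :=
  nth (0, 0) M k.

Definition valid_moves (M : seq (int * int)) : Prop :=
  (forall m, m \in M -> gcdz m.1 m.2 = 1) /\
  (forall k l : 'I_(size M), k != l ->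
     (move_of M k).1 * (move_of M l).2 - (move_of M l).1 * (move_of M k).2 != 0).

(* Index (i, j, k) of the hyperplane H^{d/c}_{ij} with (c,d) = k-th move. *)
Definition hyp (q : nat) (M : seq (int * int)) : Type :=
  ('I_q * 'I_q * 'I_(size M))%type.

Definition on_hyp {q : nat} {M : seq (int * int)} (h : hyp q M)
    (x y : 'I_q -> int) : bool :=
  let: (i, j, k) := h in
  let: (c, d) := move_of M k in
  (x j - x i) * d - (y j - y i) * c == 0.

Arguments move_of : clear implicits.
Definition involved {q : nat} {M : seq (int * int)} (S : {set hyp q M})
    (i : 'I_q) : bool :=
  [exists h in S, (h.1.1 == i) || (h.1.2 == i)].

Definition kappa {q : nat} {M : seq (int * int)} (S : {set hyp q M}) : nat :=
  #|[set i | involved S i]|.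

(* Normal vector of a hyperplane in Q^{2q}: columns lshift = x-coords,
   rshift = y-coords. *)
Definition normal_vec {q : nat} {M : seq (int * int)} (h : hyp q M) :
    'rV[rat]_(q + q) :=
  let: (i, j, k) := h in
  let: (c, d) := move_of M k in
  \row_(col < q + q)
    match split col with
    | inl a => d%:~R * ((a == j)%:R - (a == i)%:R)
    | inr b => - c%:~R * ((b == j)%:R - (b == i)%:R)
    end.

(* codim of U = intersection of the hyperplanes in S (rank of normals). *)
Definition codim {q : nat} {M : seq (int * int)} (S : {set hyp q M}) : nat :=
  \rank (\matrix_(r < #|S|) normal_vec (@enum_val _ (mem S) r)).

(* alpha(U; n): integral points of (n+1)((0,1)^{2 kappa} cap U~), i.e.
   placements of the involved pieces on {1..n}^2 satisfying the equations
   of S (uninvolved pieces are fixed at (0,0), so they are not counted). *)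
Definition alpha {q : nat} {M : seq (int * int)} (S : {set hyp q M})
    (n : nat) : nat :=
  #|[set f : {ffun 'I_q -> 'I_n.+1 * 'I_n.+1} |
      [forall i, if involved S i then (0 < (f i).1)%N && (0 < (f i).2)%N
                 else f i == (ord0, ord0)] &&
      [forall h in S, on_hyp h (fun i => ((f i).1 : nat)%:Z)
                               (fun i => ((f i).2 : nat)%:Z)]]|.

(* Main.v *)
Require Import Defs.
From HB Require Import structures.
From mathcomp Require Import all_boot all_order all_algebra.
From mathcomp Require Import zify.
Import Order.TTheory GRing.Theory Num.Theory.
Local Open Scope ring_scope.

(* Put D_i := B_i - A_i.  The top coefficients agree, so size D_i <= d; the D_i
   satisfy the same reciprocity D_{-i}(-x) = (-1)^d D_i(x), and D_{n mod p}(n) = 0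
   for 0 <= n < N.  Indexing the constituents by all integers, reciprocity turns
   the zero at n into a zero at -n, so D_i vanishes at every integer of its class
   mod p in the window (-N, N).  These 2N - 1 consecutive integers contain d
   points of every class, except when pd = 2N: then the class of N has only d - 1
   of them, but it is closed under negation (2N = 0 mod p) and d is odd, so D_i
   is odd and vanishes at 0 as well.  Either way D_i has d roots, hence D_i = 0. *)

Lemma size_polyB_cancel (R : nzRingType) (P Q : {poly R}) (d : nat) :
  (size P <= d.+1)%N -> (size Q <= d.+1)%N -> P`_d = Q`_d -> (size (P - Q)%R <= d)%N.
Proof.
move=> szP szQ eq_d; apply/leq_sizeP => k; rewrite leq_eqVlt coefB.
case/predU1P=> [<-|lt_dk]; first by rewrite eq_d subrr.
by rewrite !nth_default ?subr0 // (leq_trans _ lt_dk).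
Qed.

Section WindowRoots.
Variable R : numDomainType.

Definition progression (b : int) (p n : nat) : seq R :=
  [seq (b + (k * p)%N%:Z)%:~R | k <- iota 0 n].

Lemma size_progression b p n : size (progression b p n) = n.
Proof. by rewrite size_map size_iota. Qed.

Lemma progression_uniq b p n : (0 < p)%N -> uniq (progression b p n).
Proof.
move=> p_gt0; rewrite map_inj_in_uniq ?iota_uniq // => k l _ _ /intr_inj /addrI.
by move/eqP; rewrite eqz_nat eqn_pmul2r // => /eqP.
Qed.

Variables (p d N : nat) (a : int) (P : {poly R}).
Hypotheses (p_gt0 : (0 < p)%N) (sizeP : (size P <= d)%N).
Hypothesis N_large : ((p * d).+1./2 + ~~ odd d <= N)%N.
Hypothesis root_window :
  forall m : int, (`|m| < N)%N -> (m == a %[mod p])%Z -> root P m%:~R.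
Hypothesis P_sym :
  (- a == a %[mod p])%Z -> forall x, P.[- x] = (-1) ^+ d * P.[x].

Lemma poly_eq0_of_window_roots : P = 0.
Proof.
(* the least member of the class of a above -N *)
pose b : int := ((a + (N%:Z - 1)) %% p)%Z - (N%:Z - 1).
have b_a : (b == a %[mod p])%Z by rewrite -(eqz_modDr (N%:Z - 1)) /b subrK modz_mod.
have b_bounds : - N%:Z < b <= p%:Z - N%:Z by rewrite /b; lia.
clearbody b.
have progression_roots n : b + (n * p)%N%:Z < N%:Z + p%:Z ->
    all (root P) (progression b p n).
  move=> last_lt; apply/allP => x /mapP [k]; rewrite mem_iota => /andP [_ lt_kn] ->.
  have le_kp : (k.+1 * p <= n * p)%N by rewrite leq_mul2r lt_kn orbT.
  apply: root_window; first by lia.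
  by rewrite -(eqP b_a) PoszM addrC modzMDl.
have [last_lt|last_ge] := ltP (b + (d * p)%N%:Z) (N%:Z + p%:Z).
  apply: roots_geq_poly_eq0 (progression_roots d last_lt) (progression_uniq b p d p_gt0) _.
  by rewrite size_progression.
have [b_eq pd_eq d_odd] : [/\ b = p%:Z - N%:Z, (p * d = N.*2)%N & odd d].
  by split; lia.
have a_sym : (- a == a %[mod p])%Z.
  rewrite -modzNm -(eqP b_a) modzNm.
  have -> : - b = (d%:Z - 2) * p%:Z + b by rewrite b_eq mulrBl -PoszM mulnC pd_eq; lia.
  by rewrite modzMDl.
have P_odd x : P.[- x] = - P.[x].
  by rewrite P_sym // -signr_odd d_odd expr1 mulN1r.
have P0 : root P 0.
  by have /eqP := P_odd 0; rewrite oppr0 -addr_eq0 -mulr2n mulrn_eq0.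
have notin0 : 0 \notin progression b p d.-1.
  apply/mapP => -[k _ /esym/eqP]; rewrite intr_eq0 => /eqP k_root.
  have : (p * d = p * k.+1.*2)%N by lia.
  by move/eqP; rewrite eqn_pmul2l // => /eqP d_eq; move: d_odd; rewrite d_eq odd_double.
have d_gt0 : (0 < d)%N by rewrite odd_gt0.
apply: (@roots_geq_poly_eq0 _ _ (0 :: progression b p d.-1)).
- by rewrite /= P0 progression_roots //; lia.
- by rewrite /= notin0 progression_uniq.
- by rewrite /= size_progression prednK.
Qed.
End WindowRoots.

Lemma absz_modNz (m : int) (p : nat) : (0 < p)%N ->
  `|(- m %% p)%Z|%N = ((p - `|(m %% p)%Z|) %% p)%N.
Proof.
move=> p_gt0; apply/eqP; rewrite -eqz_nat gez0_abs ?modz_ge0 -?lt0n //.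
rewrite -modz_nat -subzn; last by rewrite -lez_nat gez0_abs ?modz_ge0 ?ltW ?ltz_pmod -?lt0n.
by rewrite gez0_abs ?modz_ge0 -?lt0n // -modzNm -modzDl.
Qed.

Section QuasiPolynomial.
Variables (R : numDomainType) (p d N : nat) (D : nat -> {poly R}).
Hypothesis p_gt0 : (0 < p)%N.
Hypothesis D_size : forall i, (i < p)%N -> (size (D i) <= d)%N.
Hypothesis D_reciprocity : forall i, (i < p)%N ->
  forall x, (D ((p - i) %% p)%N).[- x] = (-1) ^+ d * (D i).[x].
Hypothesis D_vanish : forall n, (n < N)%N -> (D (n %% p)%N).[n%:R] = 0.
Hypothesis N_large : ((p * d).+1./2 + ~~ odd d <= N)%N.

Definition constituent (m : int) : {poly R} := D `|(m %% p)%Z|.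

Lemma constituent_nat i : (i < p)%N -> constituent i = D i.
Proof. by move=> lt_ip; rewrite /constituent modz_nat modn_small. Qed.

Lemma constituent_congr m m' : (m == m' %[mod p])%Z -> constituent m = constituent m'.
Proof. by rewrite /constituent => /eqP ->. Qed.

Lemma constituent_reciprocity m x :
  (constituent (- m)).[- x] = (-1) ^+ d * (constituent m).[x].
Proof. by rewrite /constituent absz_modNz // D_reciprocity //; lia. Qed.

Lemma constituent_vanish m : (`|m| < N)%N -> (constituent m).[m%:~R] = 0.
Proof.
have vanish_nat n : (n < N)%N -> (constituent n).[n%:R] = 0.
  by move=> lt_nN; rewrite /constituent modz_nat D_vanish.
case: m => n; first exact: vanish_nat.
rewrite NegzE intrN constituent_reciprocity => /vanish_nat ->.
by rewrite mulr0.
Qed.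

Lemma quasipolynomial_eq0 i : (i < p)%N -> D i = 0.
Proof.
move=> lt_ip; rewrite -constituent_nat //.
apply: (@poly_eq0_of_window_roots _ p d N i) => //.
- by rewrite constituent_nat ?D_size.
- by move=> m lt_mN /constituent_congr <-; apply/eqP/constituent_vanish.
- by move=> /constituent_congr sym_i x; rewrite -{1}sym_i constituent_reciprocity.
Qed.

End QuasiPolynomial.

Theorem theorem2p1 (M : seq (int * int)) (q : nat) (S : {set hyp q M})
    (p : nat) (A : nat -> {poly rat}) :
  valid_moves M ->
  (forall h, h \in S -> (h.1.1 < h.1.2)%N) ->
  (0 < p)%N ->
  let c := codim S in
  let d := (2 * kappa S - c)%N in
  (* alpha(U;n) is a quasipolynomial of period p with constituents A 0..A (p-1) *)
  (forall n : nat, (alpha S n)%:R = (A (n %% p)%N).[n%:R]) ->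
  (* known facts: degree d, common leading coefficient, reciprocity *)
  (forall i, (i < p)%N -> size (A i) = d.+1) ->
  (forall i j, (i < p)%N -> (j < p)%N -> lead_coef (A i) = lead_coef (A j)) ->
  (forall i, (i < p)%N -> forall x : rat,
      (A ((p - i) %% p)%N).[- x] = (-1) ^+ d * (A i).[x]) ->
  (* the first N values determine every coefficient of every constituent *)
  let N := ((p * d).+1./2 + (if odd c then 0 else 1))%N in
  forall B : nat -> {poly rat},
    (forall i, (i < p)%N -> (size (B i) <= d.+1)%N) ->
    (forall i, (i < p)%N -> (B i)`_d = lead_coef (A 0%N)) ->
    (forall i, (i < p)%N -> forall x : rat,
        (B ((p - i) %% p)%N).[- x] = (-1) ^+ d * (B i).[x]) ->
    (forall n : nat, (n < N)%N -> (alpha S n)%:R = (B (n %% p)%N).[n%:R]) ->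
    forall i, (i < p)%N -> B i = A i.
Proof.
move=> _ _ p_gt0 c d A_vals A_size A_lead A_recip N B B_size B_top B_recip B_vals i lt_ip.
apply/eqP; rewrite -subr_eq0; apply/eqP.
have D_size j : (j < p)%N -> (size (B j - A j)%R <= d)%N.
  move=> lt_jp; apply: size_polyB_cancel; rewrite ?A_size ?B_size ?B_top //.
  by rewrite (A_lead 0%N j) // lead_coefE A_size.
(* d = 2 kappa - c is truncated, so d = 0 does not force c even and N may be 0 *)
have [d0|d_gt0] := posnP d; first by apply/eqP; rewrite -size_poly_leq0 -d0 D_size.
apply: (@quasipolynomial_eq0 _ p d N (fun j => B j - A j)) => //.
- by move=> j lt_jp x; rewrite !hornerE A_recip // B_recip // mulrBr.
- by move=> n lt_nN; rewrite !hornerE -A_vals -B_vals // subrr.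
- have odd_d : odd d = odd c by rewrite oddB ?oddM //; lia.
  by rewrite /N odd_d; case: (odd c).
Qed.
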